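(* Let $n\ge1$ and let $\psi:\mathcal{F}_n^\infty\to\mathcal{F}_n^\infty$ be defined by $\psi(P)=A^{-1}\bigl([1,n-1]\setminus A(P)\bigr)$. Then for all $P,Q\in\mathcal{F}_n^\infty$, $Q$ covers $P$ in $\mathbb{F}_n^\infty$ if and only if $\psi(P)$ covers $\psi(Q)$ in $\mathbb{F}_n^\infty$. Consequently $\psi$ (complementation of the associated subsets) is an order-reversing involution of $\mathbb{F}_n^\infty$.
   Context: A Dyck path of semilength $n\ge 0$ is a lattice path from $(0,0)$ to $(2n,0)$ with steps $U=(1,1)$ and $D=(1,-1)$ that never goes below the $x$-axis; it is identified with its word over $\{U,D\}$. A path avoids a pattern $\alpha$ if $\alpha$ does not occur as a factor (block of consecutive steps). $\mathcal{F}_n^\infty$ is the set of Dyck paths of semilength $n$ avoiding $DUU$, ordered by the Stanley order: $P\le Q$ iff $P$ lies weakly below $Q$ when both are drawn in the plane; $\mathbb{F}_n^\infty=(\mathcal{F}_n^\infty,\le)$; $Q$ covers $P$ if $P<Q$ with nothing strictly between. For $P\in\mathcal{F}_n^\infty$, write $P=U^iDR$ where $i$ is the length of the initial run of $U$ steps; then $R$ contains $n-1$ steps $D$, which are labeled $1,\dots,n-1$ from left to right. $A(P)\subseteq[1,n-1]$ is the set of labels of those $D$ steps of $R$ that are not immediately preceded by a $U$ step in $R$. The map $A$ is a bijection from $\mathcal{F}_n^\infty$ onto the set of all subsets of $[1,n-1]=\{1,\dots,n-1\}$. *)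

(* Defs.v *)
From HB Require Import structures.
From mathcomp Require Import all_boot all_order all_algebra.
From mathcomp Require Import zify.

Set Implicit Arguments.
Unset Strict Implicit.
Unset Printing Implicit Defensive.

Import Order.TTheory GRing.Theory Num.Theory.

Definition step := bool.
HB.instance Definition _ := Finite.on step.
Definition U : step := true.
Definition D : step := false.

(* Ordinate reached after the first k steps of w. *)
Definition height (w : seq step) (k : nat) : int :=
  ((count_mem U (take k w))%:Z - (count_mem D (take k w))%:Z)%R.

Definition is_dyck (w : seq step) : bool :=
  [forall k : 'I_(size w).+1, (0 <= height w k)%R] && (height w (size w) == 0%R).

Definition avoids (w alpha : seq step) : bool := ~~ infix alpha w.

Record F (n : nat) := MkF {
  path_word :> (n.*2).-tuple step;
  _ : is_dyck path_word && avoids path_word [:: D; U; U] }.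

HB.instance Definition _ n := [isSub for @path_word n].
HB.instance Definition _ n := [Finite of F n by <:].

(* Both paths are linear between consecutive integer abscissae, so comparing
   them there decides whether P lies weakly below Q. *)
Definition stanley_le n (P Q : F n) : bool :=
  [forall k : 'I_(n.*2).+1, (height P k <= height Q k)%R].

Lemma heightS w k : k < size w ->
  height w k.+1 = (height w k + if nth D w k then 1 else -1)%R.
Proof.
move=> hk; rewrite /height (take_nth D) // -cats1 !count_cat /=.
by rewrite /U /D; case: (nth false w k) => /=; lia.
Qed.

Lemma stanley_le_refl n : reflexive (@stanley_le n).
Proof. by move=> P; apply/forallP => k. Qed.

Lemma stanley_le_trans n : transitive (@stanley_le n).
Proof.
move=> Q P R /forallP h1 /forallP h2; apply/forallP => k.
exact: le_trans (h1 k) (h2 k).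
Qed.

Lemma stanley_le_anti n : antisymmetric (@stanley_le n).
Proof.
move=> P Q /andP[/forallP h1 /forallP h2].
have eqh k : k <= n.*2 -> height P k = height Q k.
  rewrite -ltnS => hk; apply/le_anti.
  by rewrite (h1 (Ordinal hk)) (h2 (Ordinal hk)).
apply/val_inj/val_inj/(@eq_from_nth _ D); rewrite !size_tuple // => k hk.
have := eqh k.+1 hk; rewrite !heightS ?size_tuple // (eqh k (ltnW hk)).
by case: (nth _ P k); case: (nth _ Q k) => //; lia.
Qed.

Fact stanley_display : Order.disp_t.
Proof. exact: Order.Disp tt tt. Qed.

HB.instance Definition _ n := Order.Le_isPOrder.Build stanley_display (F n)
  (@stanley_le_refl n) (@stanley_le_anti n) (@stanley_le_trans n).

Definition covers n (Q P : F n) : Prop :=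
  (P < Q)%O /\ ~ exists R : F n, (P < R)%O /\ (R < Q)%O.

(* The word R of the factorization w = U^i D R; index D w is the length i of
   the initial run of U steps. *)
Definition tail_word (w : seq step) : seq step := drop (index D w).+1 w.

(* r has a D step, with exactly k steps D on its left in r, that is not
   immediately preceded by a U step in r; that D step has label k+1. *)
Definition free_D (r : seq step) (k : nat) : bool :=
  [exists p : 'I_(size r), [&& nth U r p == D, count_mem D (take p r) == k
     & ~~ ((0 < p) && (nth D r p.-1 == U))]].

(* Labels are shifted: j in [1, n-1] is represented by the ordinal j-1 : 'I_n.-1, so
   {set 'I_n.-1} is the type of all subsets of [1, n-1]. *)
Definition A n (P : F n) : {set 'I_n.-1} :=
  [set k : 'I_n.-1 | free_D (tail_word P) k].

(* dec b : the word whose k-th D step is preceded by U exactly when b_k fails *)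
Definition dec (b : seq bool) : seq step :=
  flatten [seq (if x then [:: D] else [:: U; D]) | x : bool <- b].

Lemma free_DP r k : reflect
  (exists p, [/\ p < size r, nth U r p = D, count_mem D (take p r) = k
     & p = 0 \/ nth D r p.-1 = D]) (free_D r k).
Proof.
apply: (iffP existsP) => [[p /and3P[/eqP h1 /eqP h2 h3]]|[p [hp h1 h2 h3]]].
  exists p; split=> //; move: h3; rewrite negb_and -leqNgt leqn0.
  case/orP=> [/eqP h|]; first by left.
  by case: (nth D r p.-1) => // _; right.
exists (Ordinal hp); rewrite /= h1 h2 !eqxx /=.
by case: h3 => [->//|->]; rewrite andbF.
Qed.

Lemma free_dec b k : free_D (dec b) k = nth false b k.
Proof.
elim: b k => [|x b IH] k.
  by rewrite nth_nil; apply/free_DP => -[p []].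
case: x; rewrite /dec /= -/(dec b).
  case: k => [|k] /=.
    by apply/free_DP; exists 0; split=> //; left.
  rewrite -IH; apply/free_DP/free_DP => [[[|p] [hp h1 h2 h3]]|[p [hp h1 h2 h3]]] //.
    exists p; split=> //; first by move: h2 => /= []; rewrite add0n.
    by case: p {h1 h2 hp} h3 => [|p] [] // h; [left|right].
  exists p.+1; split=> //=; first by rewrite h2.
  by right; case: p {h1 h2 hp} h3 => [|p] [].
case: k => [|k] /=.
  by apply/free_DP => -[[|[|p]] [hp h1 h2 [|h3]]].
rewrite -IH; apply/free_DP/free_DP => [[[|[|p]] [hp h1 h2 h3]]|[p [hp h1 h2 h3]]] //.
  exists p; split=> //; first by move: h2 => /= []; rewrite add0n.
  by case: p {h1 h2 hp} h3 => [|p] [] // h; [left|right].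
exists p.+2; split=> //=; first by rewrite h2.
by right; case: p {h1 h2 hp} h3 => [|p] [].
Qed.

Lemma dec_surj r : avoids (D :: r) [:: D; U; U] -> last D r = D ->
  exists b, r = dec b.
Proof.
have [m] := ubnP (size r); elim: m r => // m IH [|[] r] hm ha hl.
- by exists [::].
- case: r hm ha hl => [|[] r] //= hm ha hl.
    by case/negP: ha; apply: (prefix_infix [:: D; U; U] r).
  have hr : avoids (D :: r) [:: D; U; U].
    by apply: contra ha => /infix_trans; apply; exact: (suffix_infix [:: D; U]).
  have hs : size r < m by lia.
  by have [b ->] := IH r hs hr hl; exists (false :: b).
- have hr : avoids (D :: r) [:: D; U; U].
    by apply: contra ha => /infix_trans; apply; exact: (suffix_infix [:: D]).
  by have [b ->] := IH r hm hr hl; exists (true :: b).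
Qed.

Lemma avoids_dec b : avoids (D :: dec b) [:: D; U; U].
Proof.
elim: b => [//|[] b IH]; rewrite /dec /= -/(dec b); move: IH;
  rewrite /avoids /= => /norP[h1 h2]; rewrite ?(negbTE h1) ?(negbTE h2) //.
Qed.

Lemma count_dec b :
  (count_mem D (dec b) = size b) * (count_mem U (dec b) = count negb b).
Proof.
by elim: b => [//|[] b [IH1 IH2]]; rewrite /dec /= -/(dec b) IH1 IH2 /=.
Qed.

Lemma height_U1 w k : height (U :: w) k.+1 = (1 + height w k)%R.
Proof. by rewrite /height /=; lia. Qed.

Lemma height_D1 w k : height (D :: w) k.+1 = (-1 + height w k)%R.
Proof. by rewrite /height /=; lia. Qed.

Lemma height0 w : height w 0 = 0%R.
Proof. by rewrite /height take0. Qed.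

Lemma height_nil k : height [::] k = 0%R.
Proof. by []. Qed.

Lemma height_dec b k : (0 <= (count id b)%:Z + height (dec b) k)%R.
Proof.
elim: b k => [|x b IH] k; first by rewrite height_nil.
case: x; rewrite /dec /= -/(dec b).
  by case: k => [|k]; rewrite ?height0 ?(height_U1, height_D1) //; have := IH k; lia.
case: k => [|[|k]]; rewrite ?(height_U1, height_D1) ?height0 //.
by have := IH k; rewrite ?(height_U1, height_D1); lia.
Qed.

Lemma height_U i h w : (0 <= h)%R -> (forall k, (0 <= h + i%:Z + height w k)%R) ->
  forall k, (0 <= h + height (nseq i U ++ w) k)%R.
Proof.
move=> h0; elim: i h h0 => [|i IH] h h0 hw k /=.
  by have := hw k; rewrite addr0.
case: k => [|k]; first by rewrite height0 addr0.
rewrite ?(height_U1, height_D1) /= addrA; apply: IH; first by lia.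
by move=> j; have := hw j; lia.
Qed.

Lemma index_D i w : index D (nseq i U ++ D :: w) = i.
Proof. by elim: i => [|i IH] //=; rewrite IH. Qed.

Lemma tail_wordE i w : tail_word (nseq i U ++ D :: w) = w.
Proof.
by rewrite /tail_word index_D -cat_rcons drop_size_cat // size_rcons size_nseq.
Qed.

Lemma avoids_UD i b : avoids (nseq i U ++ D :: dec b) [:: D; U; U].
Proof.
elim: i => [|i IH]; first exact: avoids_dec.
by rewrite /avoids /=.
Qed.

Lemma A_surj n (S : {set 'I_n.-1}) : exists P : F n, A P = S.
Proof.
case: n S => [|n] /= S.
  have h : is_dyck [tuple] && avoids [tuple] [:: D; U; U].
    by rewrite andbT; apply/andP; split=> //; apply/forallP.
  by exists (@MkF 0 _ h); apply/setP => -[].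
pose b := [seq i \in S | i <- enum 'I_n].
have sb : size b = n by rewrite size_map size_enum_ord.
pose w := nseq (count id b).+1 U ++ D :: dec b.
have cU : count_mem U w = n.+1.
  rewrite count_cat count_nseq /= count_dec.
  by have := count_predC id b; rewrite sb -[count (predC id) b]/(count negb b); lia.
have cD : count_mem D w = n.+1.
  by rewrite count_cat count_nseq /= count_dec sb.
have sw : size w = n.+1.*2.
  rewrite -(count_predC (pred1 U)) cU -addnn; congr (_ + _)%N.
  by rewrite -cD; apply: eq_count => -[].
have h : is_dyck (tcast sw (in_tuple w)) &&
         avoids (tcast sw (in_tuple w)) [:: D; U; U].
  rewrite val_tcast /= avoids_UD andbT; apply/andP; split.
    apply/forallP => k; have := @height_U (count id b).+1 0 (D :: dec b).
    rewrite add0r => H; have := H isT _ k; rewrite add0r; apply => -[|j].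
      by rewrite height0; lia.
    by rewrite ?(height_U1, height_D1) /=; have := height_dec b j; lia.
  by rewrite /height take_size cU cD subrr.
exists (MkF h); apply/setP => k; rewrite inE /= val_tcast /= tail_wordE free_dec.
by rewrite (nth_map k) ?size_enum_ord // nth_ord_enum.
Qed.

Lemma word_decomp n (w : seq step) : size w = n.+1.*2 -> is_dyck w ->
  avoids w [:: D; U; U] ->
  exists b, size b = n /\ w = nseq (count id b).+1 U ++ D :: dec b.
Proof.
move=> sw /andP[/forallP hd /eqP h0] ha.
have cs : count_mem U w + count_mem D w = n.+1.*2.
  have := count_predC (pred1 U) w; rewrite sw => <-; congr (_ + _)%N.
  by apply: eq_count => -[].
have ce : count_mem U w = count_mem D w.
  by move: h0; rewrite /height take_size; lia.
have hD : D \in w by rewrite -has_pred1 has_count; lia.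
have hi : w = nseq (index D w) U ++ D :: tail_word w.
  rewrite -[LHS](cat_take_drop (index D w)) (drop_nth D) ?index_mem //.
  rewrite nth_index //; congr (_ ++ _); apply/(@eq_from_nth _ D).
    by rewrite size_nseq size_take index_mem hD.
  move=> i; rewrite size_take index_mem hD => hi.
  rewrite nth_nseq hi nth_take //.
  by have := before_find D hi; case: (nth D w i).
move: hi; set i := index D w; set r := tail_word w => hi.
clearbody i r.
have hl : last D r = D.
  have : last D w = D.
    move: h0 hd; rewrite -[size w](@prednK) ?sw // => h0 hd.
    have hlt : n.+1.*2.-1 < size w by rewrite sw.
    move: h0; rewrite heightS // (last_nth D) sw /=.
    have := hd (inord n.+1.*2.-1); rewrite inordK ?sw //.
    by rewrite doubleS /=; case: (nth _ _ _) => //; lia.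
  by rewrite {1}hi last_cat.
have hr : avoids (D :: r) [:: D; U; U].
  by apply: contra ha; rewrite {1}hi; apply: infix_catl.
have [b eb] := dec_surj hr hl.
have cD : size b = n.
  by move: ce cs; rewrite hi !count_cat !count_nseq /= eb !count_dec; lia.
exists b; split=> //.
  rewrite {1}hi eb; congr (nseq _ _ ++ _).
  move: ce cs; rewrite hi !count_cat !count_nseq /= eb !count_dec cD.
  by have := count_predC id b; rewrite cD -[count (predC id) b]/(count negb b); lia.
Qed.

Lemma F_decomp n (P : F n.+1) : exists b, [/\ size b = n,
  val (path_word P) = nseq (count id b).+1 U ++ D :: dec b
  & A P = [set k : 'I_n | nth false b k]].
Proof.
case: P => w /= hP; have /andP[hd ha] := hP.
have [b [sb eb]] := word_decomp (size_tuple w) hd ha.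
exists b; split=> //; apply/setP => k.
by rewrite !inE /= [tval w]eb tail_wordE free_dec.
Qed.

Lemma A_inj n : injective (@A n).
Proof.
case: n => [|n] P Q.
  by move=> _; do 2!apply/val_inj; case: P Q => -[[] ?] ? [[[] ?] ?].
have [b [sb eP ->]] := F_decomp P; have [c [sc eQ ->]] := F_decomp Q.
move=> /setP ebc; do 2!apply/val_inj => /=; rewrite eP eQ.
suff -> : b = c by [].
apply: (@eq_from_nth _ false); rewrite ?sb ?sc // => i hi.
by have := ebc (Ordinal hi); rewrite !inE.
Qed.

Lemma A_codom n (S : {set 'I_n.-1}) : S \in codom (@A n).
Proof. by have [P <-] := A_surj S; apply: codom_f. Qed.

Definition A_inv n (S : {set 'I_n.-1}) : F n := iinv (A_codom S).

Lemma A_invK n : cancel (@A_inv n) (@A n).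
Proof. by move=> S; apply: f_iinv. Qed.

Lemma AK n : cancel (@A n) (@A_inv n).
Proof. by move=> P; apply: A_inj; rewrite A_invK. Qed.

Lemma A_bij n : bijective (@A n).
Proof. exact: Bijective (@AK n) (@A_invK n). Qed.

Definition psi n (P : F n) : F n := A_inv (~: A P).

(* Main.v *)
Require Import Defs.
From mathcomp Require Import all_boot all_order.
From mathcomp Require Import ssralg ssrnum ssrint zify.

(** A path of semilength [n.+1] is [U^(1+t) D (dec b)], where [b] is the indicator
    sequence of its subset and [t] the number of [true] in [b]. The [U] steps
    preceding its [D] step of label [j] number [1 + j] plus the number of [true]
    in [drop j b], so the Stanley order is the comparison, for every [j], of the
    numbers of [true] in [drop j b]. Negating the sequences reverses these
    comparisons, so [psi] is an anti-automorphism of the poset. *)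

(** Counting [D] from 0, number [j] in [D :: dec b] has index [j + count negb (take j b)]: each of
    the [j] entries before it contributes one [D], and each [false] among them also a [U]. A prefix
    has at most [j] steps [D] iff it stops by that index. *)
Lemma count_D_take_dec (b : seq bool) (m j : nat) : j <= size b ->
  (count_mem D (take m (D :: dec b)) <= j) = (m <= j + count negb (take j b)).
Proof.
elim: b m j => [|x b IH] [|m] [|j] //= hj; rewrite add1n ltnS.
case: x; rewrite /dec /= -/(dec b) ?add0n; first by rewrite IH.
by case: m => [|m] //=; rewrite add0n IH // add1n addnS !ltnS.
Qed.

Lemma count_D_take_path (b : seq bool) (i m j : nat) : j <= size b ->
  (count_mem D (take m (nseq i U ++ D :: dec b)) <= j)
  = (m <= i + (j + count negb (take j b))).
Proof.
move=> hj; elim: i m => [|i IH] [|m] //; last by rewrite addSn ltnS -IH.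
by rewrite add0n -count_D_take_dec.
Qed.

Lemma height_count_D (w : seq step) (m : nat) : m <= size w ->
  height w m = (m%:Z - (count_mem D (take m w)).*2%:Z)%R.
Proof.
move=> hm; rewrite /height.
have := count_predC (pred1 U) (take m w); rewrite size_takel //.
by rewrite (@eq_count _ (predC (pred1 U)) (pred1 D)) => [|[]] //; lia.
Qed.

Lemma count_D_word (n : nat) (P : F n.+1) : count_mem D P = n.+1.
Proof.
have [b [sb eP _]] := F_decomp P.
by rewrite [tval P]eP count_cat count_nseq /= count_dec sb.
Qed.

Lemma count_negb (b : seq bool) : count id b + count negb b = size b.
Proof. exact: count_predC. Qed.

(** At a given abscissa the higher path has fewer [D] steps behind it, so [P <= Q] means that no [D]
    of [Q] comes earlier than the corresponding [D] of [P]. *)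
Lemma le_count_dropP (n : nat) (P Q : F n.+1) (b c : seq bool) :
    size b = n -> size c = n ->
    val (path_word P) = nseq (count id b).+1 U ++ D :: dec b ->
    val (path_word Q) = nseq (count id c).+1 U ++ D :: dec c ->
  (P <= Q)%O <-> forall j, j <= n -> count id (drop j b) <= count id (drop j c).
Proof.
move=> sb sc eP eQ.
(* Index of the [D] number [j] in the path: the initial run counts all [true] entries of [d], and
   those in [take j d] combine with its [false] entries to give [j]. *)
have pos (d : seq bool) j : size d = n -> j <= n ->
    (count id d).+1 + (j + count negb (take j d)) = (j + j + count id (drop j d)).+1.
  move=> sd hj; rewrite -{1}(cat_take_drop j d) count_cat.
  by have := count_negb (take j d); rewrite size_takel ?sd //; lia.
have cP m j : j <= n ->
    (count_mem D (take m P) <= j) = (m <= (j + j + count id (drop j b)).+1).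
  by move=> hj; rewrite [tval P]eP count_D_take_path ?sb // pos.
have cQ m j : j <= n ->
    (count_mem D (take m Q) <= j) = (m <= (j + j + count id (drop j c)).+1).
  by move=> hj; rewrite [tval Q]eQ count_D_take_path ?sc // pos.
have heightE m : m < n.+1.*2.+1 -> (height P m <= height Q m)%R =
    (count_mem D (take m Q) <= count_mem D (take m P)).
  by move=> hm; rewrite !height_count_D ?size_tuple //; lia.
split=> [/forallP hle j hj | hle].
  (* Test the heights at the start of the [D] number [j] of [P]. *)
  set m := (j + j + count id (drop j b)).+1.
  have hm : m < n.+1.*2.+1.
    by have := count_size id (drop j b); rewrite size_drop sb /m; lia.
  rewrite -(leq_add2l (j + j)) -ltnS -/m -cQ //.
  have := hle (Ordinal hm); rewrite [nat_of_ord _]/= heightE // => /leq_trans; apply.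
  by rewrite cP.
apply/forallP => -[m hm]; rewrite [nat_of_ord _]/= heightE //.
have [hP|hP] := leqP (count_mem D (take m P)) n.
  have hmP := cP m _ hP; rewrite leqnn in hmP.
  rewrite cQ //; apply: leq_trans (esym hmP) _.
  by rewrite ltnS leq_add2l hle.
(* Here the prefix of [P] already has at least [n.+1] steps [D], the total number in [Q]. *)
apply: leq_trans hP; rewrite -[X in _ <= X](count_D_word n Q).
by rewrite -[X in _ <= count_mem D X](cat_take_drop m) count_cat leq_addr.
Qed.

Lemma psi_word (n : nat) (P : F n.+1) (b : seq bool) : size b = n ->
    val (path_word P) = nseq (count id b).+1 U ++ D :: dec b ->
  val (path_word (psi P)) =
    nseq (count id (map negb b)).+1 U ++ D :: dec (map negb b).
Proof.
move=> sb eP; have [c [sc -> /setP eA]] := F_decomp (psi P).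
suff -> : c = map negb b by [].
apply: (@eq_from_nth _ false) => [|i hi]; first by rewrite size_map sb.
have hin : i < n by rewrite -sc.
have := eA (Ordinal hin); rewrite /psi A_invK !inE /= [tval P]eP.
by rewrite tail_wordE free_dec (nth_map false) ?sb.
Qed.

Lemma psiK (n : nat) : involutive (@psi n).
Proof. by move=> P; rewrite /psi A_invK setCK AK. Qed.

Lemma psi_le (n : nat) (P Q : F n.+1) : (P <= Q)%O -> (psi Q <= psi P)%O.
Proof.
have [b [sb eP _]] := F_decomp P; have [c [sc eQ _]] := F_decomp Q.
move=> /(le_count_dropP n P Q b c sb sc eP eQ) hle.
apply/(le_count_dropP n _ _ (map negb c) (map negb b));
  rewrite ?size_map //; try exact: psi_word.
move=> j hj; rewrite -!map_drop !count_map.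
(* Both suffixes have length [n - j], so more [true] entries means fewer [false] ones. *)
have := hle j hj; have := count_negb (drop j b); have := count_negb (drop j c).
rewrite !size_drop sb sc.
rewrite -[count (preim _ _) (drop j c)]/(count negb (drop j c)).
rewrite -[count (preim _ _) (drop j b)]/(count negb (drop j b)).
by lia.
Qed.

Lemma psi_lt (n : nat) (P Q : F n.+1) : (P < Q)%O -> (psi Q < psi P)%O.
Proof.
rewrite !Order.POrderTheory.lt_neqAle => /andP[nPQ /psi_le ->].
by rewrite andbT eq_sym (inj_eq (inv_inj (psiK _))).
Qed.

Lemma psi_covers (n : nat) (P Q : F n.+1) :
  covers Q P -> covers (psi P) (psi Q).
Proof.
case=> hPQ hno; split=> [|[R [h1 h2]]]; first exact: psi_lt.
(* A path strictly between [psi Q] and [psi P] is sent by [psi] strictly between [P] and [Q]. *)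
by apply: hno; exists (psi R); rewrite -(psiK _ P) -(psiK _ Q) !psi_lt.
Qed.

Theorem theorem5p4 (n : nat) (hn : 1 <= n) :
  (forall P Q : F n, covers Q P <-> covers (psi P) (psi Q)) /\
  (forall P : F n, psi (psi P) = P) /\
  (forall P Q : F n, (P <= Q)%O -> (psi Q <= psi P)%O).
Proof.
case: n hn => // n _; split; last by split; [exact: psiK | exact: psi_le].
move=> P Q; split; first exact: psi_covers.
by move=> /psi_covers; rewrite !psiK.
Qed.
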